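(* Let $t(n)$ be the number of toothpicks added at stage $n$ of the toothpick structure. Then for all $k\ge0$ and $0\le i\le 2^k-1$, $$ t(2^k+1+i)=\begin{cases} 2\sum_{m\ge0}2^{\mathrm{wt}(i+m)-m}\binom{\mathrm{wt}(i+m)}{m}, & 0\le i\le 2^k-2;\\ 2^{k+1}, & i=2^k-1.\end{cases} $$
   Context: A toothpick is a line segment of length $1$ in the plane. The toothpick structure: at stage $1$ place a single toothpick on the $y$-axis centered at the origin; an end of a toothpick is exposed if that point is neither an end nor the midpoint of any other toothpick; at each subsequent stage, for every exposed toothpick end, place a toothpick centered at that end and perpendicular to the toothpick having that end. $\mathrm{wt}(n)$ denotes the number of $1$'s in the binary expansion of $n$; $\binom{w}{m}=0$ for $m>w$. *)

(* Defs.v *)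
From HB Require Import structures.
From mathcomp Require Export all_boot all_order all_algebra finmap.
From mathcomp Require Import zify.
From mathcomp Require Export classical_sets fsbigop reals.

Set Implicit Arguments.
Unset Strict Implicit.
Unset Printing Implicit Defensive.
Import Order.TTheory GRing.Theory Num.Theory.
Local Open Scope fset_scope.
Local Open Scope ring_scope.

Section Toothpick.
Variable R : realType.

(* All toothpicks of the structure are parallel to a coordinate axis, so a
   unit segment is encoded by its midpoint and a boolean telling whether it is
   parallel to the y-axis ([true]) or to the x-axis ([false]). *)
Record toothpick := Toothpick { midpoint : R * R; vertical : bool }.

Definition toothpick_pair (s : toothpick) : (R * R) * bool :=
  (midpoint s, vertical s).
Definition pair_toothpick (x : (R * R) * bool) : toothpick :=
  Toothpick x.1 x.2.
Lemma toothpick_pairK : cancel toothpick_pair pair_toothpick.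
Proof. by case. Qed.
HB.instance Definition _ := Choice.copy toothpick (can_type toothpick_pairK).

Definition half_vector (s : toothpick) : R * R :=
  if vertical s then (0, 1 / 2) else (1 / 2, 0).

Definition ends (s : toothpick) : {fset R * R} :=
  [fset midpoint s - half_vector s; midpoint s + half_vector s].

Definition exposed (S : {fset toothpick}) (s : toothpick) (p : R * R) : bool :=
  (p \in ends s) &&
  [forall u : S, (val u != s) ==> (p \notin ends (val u)) && (p != midpoint (val u))].

Definition perpendicular_at (s : toothpick) (p : R * R) : toothpick :=
  Toothpick p (~~ vertical s).

Definition added (S : {fset toothpick}) : {fset toothpick} :=
  [fset perpendicular_at s p | s in S, p in [fset q in ends s | exposed S s q]].

(* The structure is empty at stage 0. *)
Fixpoint structure (n : nat) : {fset toothpick} :=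
  match n with
  | 0 => fset0
  | 1 => [fset Toothpick (0, 0) true]
  | n'.+1 => structure n' `|` added (structure n')
  end.

Definition t (n : nat) : nat := #|` structure n `\` structure n.-1|.

End Toothpick.

(* The bits of [n] at positions [j >= n] vanish, because [n < 2 ^ n]. *)
Definition wt (n : nat) : nat := (\sum_(j < n) odd (n %/ 2 ^ j))%N.

Lemma leq_sum_bits n k : (2 ^ (\sum_(j < k) odd (n %/ 2 ^ j)) <= n.+1)%N.
Proof.
elim: k n => [|k IHk] n; first by rewrite big_ord0.
rewrite big_ord_recl expn0 divn1 /=.
under eq_bigr => j _ do rewrite /bump /= expnS divnMA divn2.
rewrite expnD; have := IHk n./2; set e := (2 ^ \sum_(i < k) _)%N => le_e.
have En := odd_double_half n; rewrite -[X in (_ <= X.+1)%N]En -muln2.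
by case: (odd n); rewrite ?expn1 ?expn0 ?mul1n ?add1n ?add0n; lia.
Qed.

(* Hence the sum over all [m >= 0] in the enumeration formula has only finitely
   many nonzero terms, which is what [\sum_(m \in setT)] requires. *)
Lemma bin_wt_eq0 i m : (i.+2 < m)%N -> 'C(wt (i + m), m) = 0%N.
Proof.
move=> lt_im; apply: bin_small; rewrite -(ltn_exp2l _ _ (ltnSn 1)).
apply: leq_ltn_trans (leq_sum_bits _ _) _.
case: m lt_im => [//|m] lt_im; rewrite expnS.
by have := ltn_expl m (ltnSn 1); lia.
Qed.

(* Main.v *)
(* In units of one half, a toothpick is a point of Z^2, vertical iff the sum of
   its coordinates is even, and a point is occupied one stage after exactly one
   of its two neighbours (horizontal ones if that sum is even, vertical ones
   otherwise) is.  So the birth time of a point is determined by those of its two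
   neighbours, and the whole structure is found by guessing a birth-time function
   and checking this local rule.  By symmetry it suffices to describe one octant
   [0 < y <= x], since the rest of the quadrant is the same octant delayed by one.
   In the octant, the columns from [m = 2 ^ k] to [2 * m - 1] consist of a copy of
   the first [m - 1] columns delayed by [2 * m], its mirror image in the line
   [y = m], and a copy rotated by a quarter turn and delayed by [2 * m - 1].
   With [T_k] the generating polynomial of the birth times in the columns before
   [2 ^ k], this reads
     [T_(k+1) = T_k * (1 + X^(2^(k+1)-1) + 2 X^(2^(k+1))) + X^(2^(k+1)+1)],
   and the formula comes from expanding the product of these factors. *)
From mathcomp Require Import zify ring.
Require Import Defs.
Import Order.TTheory GRing.Theory Num.Theory.

Set Implicit Arguments.
Unset Strict Implicit.
Unset Printing Implicit Defensive.

(** * Birth times in an octant *)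

(* Birth times start at 1, and 0 stands for a point that is never occupied.
   Neighbours born together block the point between them. *)
Definition birth (a c : nat) : nat :=
  if a == c then 0 else if a == 0 then c.+1 else if c == 0 then a.+1
  else (minn a c).+1.

Lemma birthC a c : birth a c = birth c a.
Proof. by rewrite /birth; (do ! case: eqP); lia. Qed.

Lemma birth_lt a c : 0 < a -> (a < c) || (c == 0) -> birth a c = a.+1.
Proof. by rewrite /birth; (do ! case: eqP); lia. Qed.

Lemma birth_same a : birth a a = 0.
Proof. by rewrite /birth eqxx. Qed.

Definition delay (s b : nat) : nat := if b == 0 then 0 else s + b.

(** The rule is invariant under a shift in time that fixes 0, so a delayed copy of a configuration
    obeying it obeys it again. *)
Lemma birth_delay s a c :
  birth (delay s a) (delay s c) = delay s (birth a c).
Proof.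
have [->|/negPf neq_ac] := eqVneq a c; first by rewrite !birth_same.
case: a c neq_ac => [|a] [|c] //= neq_ac; rewrite /birth /delay /= ?addnS //.
rewrite !eqSS eqn_add2l in neq_ac *; rewrite neq_ac /=.
by rewrite addnS addn_minr !addnS.
Qed.

Lemma delay0 s : delay s 0 = 0.
Proof. by []. Qed.

(* The last two branches are the mirror image and the rotated copy, [m] being the
   largest power of 2 with [m <= x]. *)
Fixpoint octant_birth_below (k x y : nat) : nat :=
  if k is k'.+1 then
    let m := 2 ^ k' in
    if x < m then octant_birth_below k' x y
    else if y == 0 then 0
    else if m < y then delay m.*2 (octant_birth_below k' (x - m) (y - m))
    else if y == m then (if x == m then m.*2.+1 else 0)
    else if m.*2 <= x + y
      then delay m.*2 (octant_birth_below k' (x - m) (m - y))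
      else delay m.*2.-1 (octant_birth_below k' (m - y) (x - m).+1)
  else 0.

Definition octant_birth (x y : nat) : nat := octant_birth_below x x y.

Lemma octant_birth_belowD j k x y :
  x < 2 ^ k -> octant_birth_below (j + k) x y = octant_birth_below k x y.
Proof.
move=> ltx; elim: j => [//|j IHj]; rewrite addSn /= IHj.
by rewrite (leq_trans ltx) // leq_exp2l // leq_addl.
Qed.

Lemma octant_birthE k x y :
  x < 2 ^ k -> octant_birth x y = octant_birth_below k x y.
Proof.
move=> ltx; have ltxx : x < 2 ^ x by apply: ltn_expl.
rewrite /octant_birth -(octant_birth_belowD x y ltx) addnC.
by rewrite (octant_birth_belowD k y ltxx).
Qed.

Lemma octant_birthx0 x : octant_birth x 0 = 0.
Proof.
rewrite /octant_birth; elim: {1}x => [//|k IHk] /=.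
by case: ifP.
Qed.

Lemma octant_birthDD k x y : x < 2 ^ k -> 0 < y ->
  octant_birth (2 ^ k + x) (2 ^ k + y) = delay (2 ^ k).*2 (octant_birth x y).
Proof.
move=> ltx y_gt0; rewrite (@octant_birthE k.+1) ?expnS; last by lia.
rewrite (octant_birthE _ ltx) /= ifF; last by lia.
rewrite ifF; last by lia.
by rewrite ifT; [rewrite !addKn | lia].
Qed.

Lemma octant_birthDm k x : x < 2 ^ k ->
  octant_birth (2 ^ k + x) (2 ^ k) = if x == 0 then (2 ^ k).*2.+1 else 0.
Proof.
move=> ltx; have := expn_gt0 2 k => m_gt0.
rewrite (@octant_birthE k.+1) ?expnS; last by lia.
rewrite /= ifF; last by lia.
rewrite ifF; last by lia.
by rewrite ltnn eqxx -[X in _ == X]addn0 eqn_add2l.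
Qed.

Lemma octant_birthDB k x y : x < 2 ^ k -> 0 < y <= x ->
  octant_birth (2 ^ k + x) (2 ^ k - y) = delay (2 ^ k).*2 (octant_birth x y).
Proof.
move=> ltx y_int; rewrite (@octant_birthE k.+1) ?expnS; last by lia.
rewrite (octant_birthE _ ltx) /=.
rewrite ifF; last by lia.
rewrite ifF; last by lia.
rewrite ifF; last by lia.
rewrite ifF; last by lia.
rewrite ifT; last by lia.
by congr (delay _ (octant_birth_below _ _ _)); lia.
Qed.

Lemma octant_birth_rot k x y : x < 2 ^ k -> 0 < y <= x ->
  octant_birth ((2 ^ k).-1 + y) (2 ^ k - x) =
    delay (2 ^ k).*2.-1 (octant_birth x y).
Proof.
move=> ltx y_int; rewrite (@octant_birthE k.+1) ?expnS; last by lia.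
rewrite (octant_birthE _ ltx) /=.
rewrite ifF; last by lia.
rewrite ifF; last by lia.
rewrite ifF; last by lia.
rewrite ifF; last by lia.
rewrite ifF; last by lia.
by congr (delay _ (octant_birth_below _ _ _)); lia.
Qed.

(** Points of the columns from [2 ^ k] to [2 ^ k.+1 - 1] are written through their preimages, in the
    shape in which the four equations above rewrite them. The diagonals of the reflected and the
    rotated copy are horizontally adjacent. *)
Variant octant_spec k : nat -> nat -> Prop :=
| OctantTop x y of x < 2 ^ k & 0 < y <= x :
    octant_spec k (2 ^ k + x) (2 ^ k + y)
| OctantMid x of x < 2 ^ k : octant_spec k (2 ^ k + x) (2 ^ k)
| OctantReflected x y of x < 2 ^ k & 0 < y <= x :
    octant_spec k (2 ^ k + x) (2 ^ k - y)
| OctantRotated x y of x < 2 ^ k & 0 < y <= x :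
    octant_spec k ((2 ^ k).-1 + y) (2 ^ k - x).

Lemma octantP k x y : 2 ^ k <= x < 2 ^ k.+1 -> 0 < y <= x -> octant_spec k x y.
Proof.
rewrite expnS => x_int y_int; case: (ltngtP y (2 ^ k)) => [lty|gty|->].
- have [le_xy|gt_xy] := leqP (2 ^ k).*2 (x + y).
    have -> : x = 2 ^ k + (x - 2 ^ k) by lia.
    have -> : y = 2 ^ k - (2 ^ k - y) by lia.
    by apply: OctantReflected; lia.
  have -> : x = (2 ^ k).-1 + (x - (2 ^ k).-1) by lia.
  have -> : y = 2 ^ k - (2 ^ k - y) by lia.
  by apply: OctantRotated; lia.
- have -> : x = 2 ^ k + (x - 2 ^ k) by lia.
  have -> : y = 2 ^ k + (y - 2 ^ k) by lia.
  by apply: OctantTop; lia.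
have -> : x = 2 ^ k + (x - 2 ^ k) by lia.
by apply: OctantMid; lia.
Qed.

Definition no_sooner (n b : nat) : bool := (b == 0) || (n <= b).

Lemma no_sooner_delay s n p b :
  no_sooner n b -> p <= s + n -> no_sooner p (delay s b).
Proof. by rewrite /no_sooner /delay; case: b => //= b; lia. Qed.

Lemma trunc_log2P x : 0 < x -> exists k, 2 ^ k <= x < 2 ^ k.+1.
Proof. by move=> x_gt0; exists (trunc_log 2 x); apply: trunc_log_bounds. Qed.

(** Each kind of copy preserves this bound. It later shows that a neighbour lying further right is
    born too late to matter. *)
Lemma octant_birth_ge x y : 0 < y <= x ->
  no_sooner x.*2.+1 (octant_birth x y).
Proof.
elim/ltn_ind: x y => x IH y yx.
have [|k /octantP/(_ yx) xyP] := @trunc_log2P x; first by lia.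
have m_gt0 := expn_gt0 2 k.
case: xyP IH => {yx}{}x => [{}y ltx yx|ltx|{}y ltx yx|{}y ltx yx] IH.
- rewrite octant_birthDD; try lia.
  by apply: no_sooner_delay (IH x _ y yx) _; lia.
- by rewrite octant_birthDm //; case: eqP => // ->; rewrite /no_sooner; lia.
- by rewrite octant_birthDB //; apply: no_sooner_delay (IH x _ y yx) _; lia.
rewrite octant_birth_rot //.
by apply: no_sooner_delay (IH x _ y yx) _; lia.
Qed.

Lemma octant_birth_diag d : 0 < d -> octant_birth d d = d.*2.+1.
Proof.
elim/ltn_ind: d => d IH d_gt0; have [k d_int] := trunc_log2P d_gt0.
have m_gt0 := expn_gt0 2 k.
have -> : d = 2 ^ k + (d - 2 ^ k) by lia.
have ltd : d - 2 ^ k < 2 ^ k by rewrite expnS in d_int; lia.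
have [->|e_gt0] := posnP (d - 2 ^ k).
  by rewrite {2}addn0 octant_birthDm // addn0.
by rewrite octant_birthDD // IH /delay /=; lia.
Qed.

(** In the last column of a block the odd heights attain the bound of [octant_birth_ge]; translation
    and reflection keep this pattern because [2 ^ k] is even for [k > 0]. *)
Lemma octant_birth_last k y : 0 < y < 2 ^ k ->
  octant_birth (2 ^ k).-1 y = if odd y then (2 ^ k).*2.-1 else 0.
Proof.
elim: k y => [|k IHk] y; first by rewrite expn0; lia.
rewrite expnS => y_int; have m_gt0 := expn_gt0 2 k.
have [k0|k_gt0] := posnP k.
  by move: y_int; rewrite k0 => ?; have ->: y = 1 by lia.
have even_m : ~~ odd (2 ^ k) by rewrite oddX; case: (k) k_gt0.
have -> : (2 * 2 ^ k).-1 = 2 ^ k + (2 ^ k).-1 by lia.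
have [lty|gty|->] := ltngtP y (2 ^ k).
- have -> : odd y = odd (2 ^ k - y).
    by rewrite oddB ?(negPf even_m) //; exact: ltnW.
  have {1}-> : y = 2 ^ k - (2 ^ k - y) by lia.
  rewrite octant_birthDB ?IHk; try lia.
  by rewrite /delay; case: odd => //; case: eqP; lia.
- have -> : odd y = odd (y - 2 ^ k).
    by rewrite oddB ?(negPf even_m) ?addbF //; exact: ltnW.
  have {1}-> : y = 2 ^ k + (y - 2 ^ k) by lia.
  rewrite octant_birthDD ?IHk; try lia.
  by rewrite /delay; case: odd => //; case: eqP; lia.
rewrite octant_birthDm; try lia.
rewrite (negPf even_m) ifF //; case: (k) k_gt0 => // k' _.
by rewrite expnS; have := expn_gt0 2 k'; lia.
Qed.

Lemma octant_birth_last2 k y : odd y -> y < (2 ^ k).-1 ->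
  octant_birth (2 ^ k).-2 y = (2 ^ k).*2.-2.
Proof.
elim: k y => [//|k IHk] y oddy.
rewrite expnS => lty; have m_gt0 := expn_gt0 2 k.
have [k0|k_gt0] := posnP k.
  by move: lty oddy; rewrite k0; case: (y) => [|[]].
have even_m : ~~ odd (2 ^ k) by rewrite oddX; case: (k) k_gt0.
have neq : y <> 2 ^ k by move=> yE; rewrite -yE oddy in even_m.
have y_gt0 : 0 < y by case: (y) oddy.
have m_gt1 : 1 < 2 ^ k by rewrite (@ltn_exp2l 2 0).
(* Height 1 is the rotated image of the diagonal point of the last column; the other heights come
   from the reflected and translated copies. *)
have [y1|neq1] := eqVneq y 1.
  have -> : (2 * 2 ^ k).-2 = (2 ^ k).-1 + (2 ^ k).-1 by lia.
  have -> : y = 2 ^ k - (2 ^ k).-1 by lia.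
  rewrite octant_birth_rot; try lia.
  by rewrite octant_birth_diag /delay /=; lia.
have -> : (2 * 2 ^ k).-2 = 2 ^ k + (2 ^ k).-2 by lia.
have y_neq2 : y <> (2 * 2 ^ k) - 2 by lia.
have [lty'|gty] := ltnP y (2 ^ k).
  have -> : y = 2 ^ k - (2 ^ k - y) by lia.
  rewrite octant_birthDB ?IHk; try lia.
  by rewrite /delay; case: eqP; lia.
have -> : y = 2 ^ k + (y - 2 ^ k) by lia.
rewrite octant_birthDD ?IHk; try lia.
by rewrite /delay; case: eqP; lia.
Qed.

Lemma octant_birthDDx k x y : 0 < x < 2 ^ k ->
  octant_birth (2 ^ k + x) (2 ^ k + y) = delay (2 ^ k).*2 (octant_birth x y).
Proof.
case/andP=> x_gt0 ltx; have [->|y_gt0] := posnP y; last exact: octant_birthDD.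
by rewrite addn0 octant_birthDm // octant_birthx0; case: (x) x_gt0.
Qed.

Lemma octant_birthDBx k x y : 0 < x < 2 ^ k -> y <= x ->
  octant_birth (2 ^ k + x) (2 ^ k - y) = delay (2 ^ k).*2 (octant_birth x y).
Proof.
case/andP=> x_gt0 ltx leyx; have [->|y_gt0] := posnP y.
  by rewrite subn0 octant_birthDm // octant_birthx0; case: (x) x_gt0.
by rewrite octant_birthDB // y_gt0.
Qed.

(** * The local rule inside the octant *)

Definition octant_step (x y : nat) : nat :=
  if odd (x + y) then birth (octant_birth x y.-1) (octant_birth x y.+1)
  else birth (octant_birth x.-1 y) (octant_birth x.+1 y).

(** When the sum is even, the right neighbour lies in the next block, out of reach of the copying
    argument, so the rule is checked on explicit values. When it is odd, the neighbours are vertical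
    and copying works. *)
Lemma octant_step_last k y : 0 < y < (2 ^ k).-1 ->
  octant_birth (2 ^ k).-1 y = octant_step (2 ^ k).-1 y \/ odd ((2 ^ k).-1 + y).
Proof.
move=> y_int; have m_gt0 := expn_gt0 2 k.
have [odd_sum|even_sum] := boolP (odd ((2 ^ k).-1 + y)); [by right | left].
have k_gt0 : 0 < k by case: (k) y_int => //; rewrite expn0; lia.
have even_m : ~~ odd (2 ^ k) by rewrite oddX; case: (k) k_gt0.
have oddy : odd y.
  move: even_sum even_m m_gt0; case: (2 ^ k) => //= m.
  by rewrite oddD negbK => + odd_m _; rewrite odd_m addTb negbK.
rewrite octant_birth_last; try lia.
rewrite oddy /octant_step (negPf even_sum) octant_birth_last2 //; try lia.
have := @octant_birth_ge (2 ^ k).-1.+1 y; rewrite /no_sooner => H.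
by rewrite birth_lt; lia.
Qed.

Lemma octant_step_DD k x y : 0 < y < x -> x < 2 ^ k -> 0 < k ->
  odd (x + y) || (x.+1 < 2 ^ k) ->
  octant_step (2 ^ k + x) (2 ^ k + y) = delay (2 ^ k).*2 (octant_step x y).
Proof.
move=> yx ltx k_gt0 ltx1; rewrite /octant_step.
have -> : odd (2 ^ k + x + (2 ^ k + y)) = odd (x + y).
  by rewrite addnACA addnn oddD odd_double.
have [odd_xy|even_xy] := ifP.
  have -> : (2 ^ k + y).-1 = 2 ^ k + y.-1 by lia.
  by rewrite -addnS !octant_birthDDx ?birth_delay; lia.
have -> : (2 ^ k + x).-1 = 2 ^ k + x.-1 by lia.
by rewrite -addnS !octant_birthDDx ?birth_delay; lia.
Qed.

Lemma octant_step_DB k x y : 0 < y < x -> x < 2 ^ k -> 0 < k ->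
  odd (x + y) || (x.+1 < 2 ^ k) ->
  octant_step (2 ^ k + x) (2 ^ k - y) = delay (2 ^ k).*2 (octant_step x y).
Proof.
move=> yx ltx k_gt0 ltx1; rewrite /octant_step.
have -> : odd (2 ^ k + x + (2 ^ k - y)) = odd (x + y).
  have -> : 2 ^ k + x + (2 ^ k - y) = (2 ^ k - y).*2 + (x + y) by lia.
  by rewrite oddD odd_double.
have [odd_xy|even_xy] := ifP.
  have -> : (2 ^ k - y).-1 = 2 ^ k - y.+1 by lia.
  have -> : (2 ^ k - y).+1 = 2 ^ k - y.-1 by lia.
  by rewrite birthC !octant_birthDBx ?birth_delay; lia.
have -> : (2 ^ k + x).-1 = 2 ^ k + x.-1 by lia.
by rewrite -addnS !octant_birthDBx ?birth_delay; lia.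
Qed.

(** The left neighbour is the adjacent diagonal point of the rotated copy, born exactly one stage
    earlier. *)
Lemma octant_step_DBdiag k x : 0 < x < 2 ^ k ->
  octant_birth (2 ^ k + x) (2 ^ k - x) = octant_step (2 ^ k + x) (2 ^ k - x).
Proof.
move=> ltx; rewrite /octant_step.
have -> : odd (2 ^ k + x + (2 ^ k - x)) = false.
  have -> : 2 ^ k + x + (2 ^ k - x) = (2 ^ k).*2 by lia.
  by rewrite odd_double.
have -> : (2 ^ k + x).-1 = (2 ^ k).-1 + x by lia.
rewrite octant_birthDBx // octant_birth_rot; try lia.
rewrite octant_birth_diag; try lia.
have := @octant_birth_ge (2 ^ k + x).+1 (2 ^ k - x); rewrite /no_sooner => H.
by rewrite birth_lt /delay /=; lia.
Qed.

(** For odd [x] the neighbours are mirror images, born together; for even [x] they lie on the mirror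
    line and are never occupied. *)
Lemma octant_step_mid k x : 0 < x < 2 ^ k -> 0 < k ->
  odd x || (x.+1 < 2 ^ k) -> octant_step (2 ^ k + x) (2 ^ k) = 0.
Proof.
move=> ltx k_gt0 ltx1; rewrite /octant_step addnAC addnn oddD odd_double addFb.
have [odd_x|even_x] := ifP.
  have -> : (2 ^ k).-1 = 2 ^ k - 1 by lia.
  rewrite -[(2 ^ k).+1]addn1 octant_birthDDx // octant_birthDBx; try lia.
  exact: birth_same.
have -> : (2 ^ k + x).-1 = 2 ^ k + x.-1 by lia.
rewrite -addnS !octant_birthDm; try lia.
by rewrite !ifF //; case: (x) ltx even_x => [|[]].
Qed.

(** The quarter turn flips the parity of the coordinate sum, so it exchanges horizontal and vertical
    neighbours just as the rule demands. Only the borders of the copy need care. *)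
Lemma octant_step_rot k x y : 0 < y < x -> x < 2 ^ k -> 0 < k ->
  octant_birth x y = octant_step x y ->
  octant_step ((2 ^ k).-1 + y) (2 ^ k - x) =
    delay (2 ^ k).*2.-1 (octant_birth x y).
Proof.
move=> yx ltx k_gt0 xyE.
have even_m : odd (2 ^ k) = false by rewrite oddX; case: (k) k_gt0.
have := xyE; rewrite /octant_step => ->.
have -> : odd ((2 ^ k).-1 + y + (2 ^ k - x)) = ~~ odd (x + y).
  have -> : (2 ^ k).-1 + y + (2 ^ k - x) = (2 ^ k - x).*2 + (x + y).-1 by lia.
  rewrite oddD odd_double addFb.
  have: 0 < x + y by lia.
  by case: (x + y) => //= n _; rewrite negbK.
rewrite if_neg; have [odd_xy|even_xy] := ifP.
  rewrite -addnS octant_birth_rot -?birth_delay; try lia.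
  (* For [y = 1] the left neighbour is in column [(2 ^ k).-1] at an even height, hence empty like
     the point [(x, 0)] it stands for. *)
  congr birth; have [y1|y_neq1] := eqVneq y 1; last first.
    have -> : ((2 ^ k).-1 + y).-1 = (2 ^ k).-1 + y.-1 by lia.
    by rewrite octant_birth_rot; lia.
  rewrite y1 addn1 /= octant_birthx0 octant_birth_last; try lia.
  rewrite oddB; try lia.
  by rewrite even_m addFb; move: odd_xy; rewrite y1 addn1 /= => /negPf->.
have -> : (2 ^ k - x).+1 = 2 ^ k - x.-1 by lia.
rewrite octant_birth_rot; try lia.
have -> : (2 ^ k - x).-1 = 2 ^ k - x.+1 by lia.
(* Here the neighbour below is on the axis and empty, while the right neighbour of [(x, y)] is born
   late; in both cases column [(2 ^ k).-2] decides. *)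
have [xm|x_neq] := eqVneq x.+1 (2 ^ k).
  have oddy : odd y.
    have: odd (2 ^ k + y) = ~~ odd (x + y) by rewrite -xm.
    by rewrite oddD even_m addFb even_xy.
  rewrite xm subnn octant_birthx0.
  have -> : x = (2 ^ k).-1 by lia.
  have := @octant_birth_ge (2 ^ k) y; rewrite /no_sooner => H.
  rewrite octant_birth_last2 //; try lia.
  by rewrite birthC !birth_lt /delay; do ? case: eqP; lia.
rewrite octant_birth_rot; try lia.
by rewrite birth_delay birthC.
Qed.

(** The neighbour above, born one stage earlier, is a diagonal point of the reflected copy or, for
    [x = 1], the corner [(2 ^ k, 2 ^ k)]. *)
Lemma octant_step_rotdiag k x : 0 < x < 2 ^ k -> 0 < k ->
  octant_birth ((2 ^ k).-1 + x) (2 ^ k - x) =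
  octant_step ((2 ^ k).-1 + x) (2 ^ k - x).
Proof.
move=> ltx k_gt0; rewrite /octant_step.
have -> : odd ((2 ^ k).-1 + x + (2 ^ k - x)).
  have -> : (2 ^ k).-1 + x + (2 ^ k - x) = (2 ^ k).-1.*2.+1 by lia.
  by rewrite /= odd_double.
rewrite octant_birth_rot; try lia.
rewrite octant_birth_diag; try lia.
have -> : (2 ^ k - x).+1 = 2 ^ k - x.-1 by lia.
have -> : (2 ^ k - x).-1 = 2 ^ k - x.+1 by lia.
have -> : octant_birth ((2 ^ k).-1 + x) (2 ^ k - x.-1) = (2 ^ k).*2 + x.*2.-1.
  have [->|x_neq1] := eqVneq x 1.
    by rewrite subn0 addn1 prednK ?expn_gt0 // octant_birth_diag ?expn_gt0; lia.
  have -> : (2 ^ k).-1 + x = 2 ^ k + x.-1 by lia.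
  rewrite octant_birthDB; try lia.
  by rewrite octant_birth_diag /delay /=; lia.
suff H : no_sooner ((2 ^ k).*2 + x.*2) (octant_birth ((2 ^ k).-1 + x) (2 ^ k - x.+1)).
  move: H; rewrite /no_sooner birthC => H; by rewrite birth_lt /delay /=; lia.
have [xm|x_neq] := eqVneq x.+1 (2 ^ k); first by rewrite xm subnn octant_birthx0.
rewrite octant_birth_rot; try lia.
by apply: no_sooner_delay (octant_birth_ge _) _; lia.
Qed.

Lemma octant_birth_step x y : 0 < y < x -> octant_birth x y = octant_step x y.
Proof.
elim/ltn_ind: x y => x IH y yx.
have [|k x_int] := @trunc_log2P x; first by lia.
have yx' : 0 < y <= x by lia.
have m_gt0 := expn_gt0 2 k.
have k_gt0 : 0 < k.
  by case: (k) x_int => //; rewrite expn0 expn1; lia.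
have ltx1 : octant_birth x y = octant_step x y \/
    odd (x + y) || (x.+1 < 2 ^ k.+1).
  have [xE|x_neq] := eqVneq x.+1 (2 ^ k.+1).
    have := @octant_step_last k.+1 y; rewrite -xE /= => /(_ yx) [->|->];
      [by left | by right].
  by right; rewrite ltn_neqAle x_neq; case/andP: x_int => _ ->; rewrite orbT.
case: ltx1 => // ltx1.
have even_m : odd (2 ^ k) = false by rewrite oddX; case: (k) k_gt0.
case: (octantP x_int yx') IH yx ltx1 => {x_int yx'}{}x.
- move=> {}y ltx yx' IH yx ltx1; rewrite octant_birthDDx ?IH; try lia.
  rewrite octant_step_DD //; try lia.
  move: ltx1; rewrite addnACA addnn oddD odd_double addFb.
  by case: odd => //; rewrite expnS; lia.
- move=> ltx IH yx ltx1; rewrite octant_step_mid //; try lia.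
  by rewrite octant_birthDm // ifF //; lia.
- move=> {}y ltx yx' IH yx ltx1.
  have [<-|neq_xy] := eqVneq y x; first by apply: octant_step_DBdiag; lia.
  rewrite octant_birthDBx ?IH; try lia.
  rewrite octant_step_DB //; try lia.
  move: ltx1; have -> : 2 ^ k + x + (2 ^ k - y) = (2 ^ k - y).*2 + (x + y) by lia.
  rewrite oddD odd_double addFb.
  by case: odd => //; rewrite expnS; lia.
move=> {}y ltx yx' IH yx ltx1.
have [<-|neq_xy] := eqVneq y x; first by apply: octant_step_rotdiag; lia.
rewrite octant_step_rot ?octant_birth_rot //; try lia.
by apply: IH; lia.
Qed.

(** * Birth times on the grid *)

(** Above the diagonal, [(x, y)] corresponds to the octant point [(y - 1, x)]. The axes carry only
    the initial toothpick and those grown from its ends at stage 2. *)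
Definition quadrant_birth (x y : nat) : nat :=
  if x == 0 then (if y == 0 then 1 else if y == 1 then 2 else 0)
  else if y == 0 then 0
  else if y <= x then octant_birth x y
  else delay 1 (octant_birth y.-1 x).

Lemma quadrant_birthx0 x : 0 < x -> quadrant_birth x 0 = 0.
Proof. by case: x. Qed.

Lemma quadrant_birth0y y : 1 < y -> quadrant_birth 0 y = 0.
Proof. by case: y => [|[]]. Qed.

Lemma quadrant_birth_low x y : y <= x -> 0 < x ->
  quadrant_birth x y = octant_birth x y.
Proof.
move=> leyx x_gt0; rewrite /quadrant_birth leyx gtn_eqF //.
by case: eqP => // ->; rewrite octant_birthx0.
Qed.

Lemma quadrant_birth_high x y : x < y -> 1 < y ->
  quadrant_birth x y = delay 1 (octant_birth y.-1 x).
Proof.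
move=> ltxy y_gt1; rewrite /quadrant_birth leqNgt ltxy /=.
have [->|x_gt0] := posnP x; first last.
  by rewrite ifF //; lia.
by rewrite octant_birthx0; case: y y_gt1 {ltxy} => [|[]].
Qed.

Lemma quadrant_birth_step x y : 0 < x -> 0 < y ->
  quadrant_birth x y =
    if odd (x + y) then birth (quadrant_birth x y.-1) (quadrant_birth x y.+1)
    else birth (quadrant_birth x.-1 y) (quadrant_birth x.+1 y).
Proof.
move=> x_gt0 y_gt0; have [ltyx|ltxy|<-] := ltngtP y x.
- rewrite quadrant_birth_low ?octant_birth_step /octant_step; try lia.
  by case: ifP => _; rewrite !quadrant_birth_low; lia.
- rewrite quadrant_birth_high; try lia.
  have [y_eq|y_neq] := eqVneq y x.+1.
    rewrite y_eq addnS addnn /= odd_double octant_birth_diag //=.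
    rewrite quadrant_birth_low ?octant_birth_diag // quadrant_birth_high; try lia.
    have := @octant_birth_ge x.+1 x; rewrite /no_sooner /= => H.
    by rewrite birth_lt ?add1n //; rewrite /delay; case: eqP; lia.
  have -> : octant_birth y.-1 x = octant_step y.-1 x by apply: octant_birth_step; lia.
  have odd_flip : odd (y.-1 + x) = ~~ odd (x + y).
    have -> : x + y = (y.-1 + x).+1 by lia.
    by rewrite /= negbK.
  rewrite /octant_step odd_flip if_neg; case: ifP => _; rewrite -birth_delay.
    by rewrite !quadrant_birth_high //; try lia; rewrite prednK //; lia.
  rewrite (@quadrant_birth_high x.+1); try lia.
  have [->|x_neq1] := eqVneq x 1; last by rewrite quadrant_birth_high //; lia.
  by rewrite /= octant_birthx0 quadrant_birth0y ?delay0 //; lia.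
rewrite addnn odd_double quadrant_birth_low // octant_birth_diag //.
have -> : quadrant_birth y.-1 y = y.*2.
  have [->//|y_neq1] := eqVneq y 1.
  rewrite quadrant_birth_high ?octant_birth_diag /delay /=; lia.
rewrite quadrant_birth_low; try lia.
have := @octant_birth_ge y.+1 y; rewrite /no_sooner => H.
by rewrite birth_lt; lia.
Qed.

Definition grid_birth (p : int * int) : nat := quadrant_birth `|p.1| `|p.2|.

(** Odd points carry horizontal toothpicks, which grow from ends of vertical ones; this is why their
    neighbours are the vertical ones. *)
Definition grid_odd (p : int * int) : bool := odd (`|p.1| + `|p.2|).

Definition grid_shift (vert : bool) (e : int) (p : int * int) : int * int :=
  if vert then (p.1, p.2 + e)%R else (p.1 + e, p.2)%R.

Lemma odd_absz_add1 (x e : int) : (`|e| = 1)%N -> odd (absz (x + e)%R) = ~~ odd `|x|.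
Proof. by lia. Qed.

Lemma grid_odd_shift b e p : (`|e| = 1)%N -> grid_odd (grid_shift b e p) = ~~ grid_odd p.
Proof.
move=> e1; rewrite /grid_odd /grid_shift.
by case: b; rewrite /= !oddD odd_absz_add1 ?addbN ?addNb.
Qed.

Lemma grid_shiftK b e : cancel (grid_shift b e) (grid_shift b (- e)%R).
Proof. by case: b => -[x y]; rewrite /grid_shift /= addrK. Qed.

(** The toothpick at the origin is given, not grown. On the axes the two neighbours are mirror
    images or both empty, save at [(0, 1)] and [(0, -1)]; elsewhere a negative coordinate merely
    swaps them. *)
Lemma grid_birth_step p : p != (0, 0)%R ->
  grid_birth p = birth (grid_birth (grid_shift (grid_odd p) 1%R p))
                       (grid_birth (grid_shift (grid_odd p) (- 1)%R p)).
Proof.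
case: p => x y; rewrite /grid_birth /grid_shift /grid_odd -pair_eqE /= => xy_neq0.
have [x0|x_neq0] := eqVneq x 0%R.
  rewrite x0 !add0r absz0 add0n /=; case: ifP => odd_y /=; last first.
    rewrite birth_same quadrant_birth0y //; lia.
  have [y_gt1|y_le1] := ltnP 1 `|y|.
    by rewrite !quadrant_birth0y //; lia.
  have /orP[/eqP->//|/eqP->//] : (y == 1%R) || (y == (- 1)%R) by lia.
have [y0|y_neq0] := eqVneq y 0%R.
  rewrite y0 !add0r absz0 addn0 /=; case: ifP => odd_x /=.
    by rewrite birth_same quadrant_birthx0 //; lia.
  by rewrite !quadrant_birthx0 //; lia.
rewrite quadrant_birth_step; try lia.
case: ifP => _ /=.
  have [y_gt0|y_le0] := ltrP 0 y.
    rewrite birthC; congr (birth (quadrant_birth _ _) (quadrant_birth _ _)); lia.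
  congr (birth (quadrant_birth _ _) (quadrant_birth _ _)); lia.
have [x_gt0|x_le0] := ltrP 0 x.
  rewrite birthC; congr (birth (quadrant_birth _ _) (quadrant_birth _ _)); lia.
congr (birth (quadrant_birth _ _) (quadrant_birth _ _)); lia.
Qed.

(** * Toothpicks and grid points *)

Section Grid.
Local Open Scope fset_scope.
Local Open Scope ring_scope.
Variable R : realType.

Definition grid_point (p : int * int) : R * R := (p.1%:~R / 2, p.2%:~R / 2).

Definition grid_toothpick (p : int * int) : toothpick R :=
  Toothpick (grid_point p) (~~ grid_odd p).

Lemma grid_point_inj : injective grid_point.
Proof.
case=> x y [x' y'] [] /=.
have two_neq0 : (2 : R)^-1 != 0 by rewrite invr_eq0 pnatr_eq0.
by move=> /(mulIf two_neq0)/intr_inj-> /(mulIf two_neq0)/intr_inj->.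
Qed.

Lemma grid_toothpick_inj : injective grid_toothpick.
Proof. by move=> p q /(congr1 (@midpoint R))/grid_point_inj. Qed.

Lemma grid_shift_point b e p :
  grid_point (grid_shift b e p) =
    grid_point p + (if b then (0, e%:~R / 2) else (e%:~R / 2, 0)).
Proof.
case: p => x y; rewrite /grid_point /grid_shift.
by case: b; congr (_, _); rewrite /= ?addr0 // intrD mulrDl.
Qed.

Lemma ends_grid_toothpick p v :
  reflect (exists2 e : int, `|e|%N = 1%N &
             v = grid_point (grid_shift (~~ grid_odd p) e p))
    (v \in ends (grid_toothpick p)).
Proof.
have halfN (b : bool) : (if b then (0, - 1 / 2) else (- 1 / 2, 0)) =
    - (if b then (0, 1 / 2) else (1 / 2, 0)) :> R * R.
  by case: b; congr (_, _); rewrite /= ?oppr0 ?mulNr.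
rewrite /ends /half_vector /= !inE.
apply: (iffP orP) => [[]/eqP->|[e e1 ->]].
- by exists (- 1) => //; rewrite grid_shift_point mulrN1z halfN.
- by exists 1 => //; rewrite grid_shift_point.
have /orP[] : (e == 1) || (e == - 1) by lia.
  by move/eqP->; right; rewrite grid_shift_point.
by move/eqP->; left; rewrite grid_shift_point mulrN1z halfN.
Qed.

Definition born_by (n : nat) (p : int * int) : bool := (0 < grid_birth p <= n)%N.

Lemma grid_birth_neighbor p e : p != (0, 0) -> `|e|%N = 1%N ->
  grid_birth p = birth (grid_birth (grid_shift (grid_odd p) e p))
                       (grid_birth (grid_shift (grid_odd p) (- e) p)).
Proof.
move=> p_neq0 e1; have /orP[/eqP->|/eqP->] : (e == 1) || (e == - 1) by lia.
  exact: grid_birth_step.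
by rewrite opprK birthC; exact: grid_birth_step.
Qed.

Lemma born_next n a c : (0 < n)%N -> (0 < a <= n)%N -> ~~ (0 < c <= n)%N ->
  ~~ (0 < birth a c <= n)%N -> birth a c = n.+1.
Proof. by move=> n_gt0 an cn; rewrite birth_lt; lia. Qed.

Lemma birth_eqS n a c : (0 < n)%N -> birth a c = n.+1 ->
  (0 < a <= n)%N && ~~ (0 < c <= n)%N \/ (0 < c <= n)%N && ~~ (0 < a <= n)%N.
Proof.
rewrite /birth => n_gt0; case: eqP => // neq_ac; case: eqP => [|a_neq0]; first by lia.
by case: eqP => [|c_neq0]; lia.
Qed.

(** * One stage of the growth *)

Section Stage.
Variables (n : nat) (S : {fset toothpick R}).
Hypothesis n_gt0 : (0 < n)%N.
Hypothesis S_def : forall s,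
  reflect (exists2 p, s = grid_toothpick p & born_by n p) (s \in S).

Lemma mem_stage p : (grid_toothpick p \in S) = born_by n p.
Proof. by apply/S_def/idP => [[q /grid_toothpick_inj->]|]; last exists p. Qed.

(** Besides [p], only the opposite neighbour [p'] can have an end at [q], and only [q] itself is
    centred there. The end is exposed iff neither is born by stage [n], and the local rule then
    dates [q]. *)
Lemma exposed_grid_toothpick p e : born_by n p -> `|e|%N = 1%N ->
  let q := grid_shift (~~ grid_odd p) e p in
  exposed S (grid_toothpick p) (grid_point q) = (grid_birth q == n.+1).
Proof.
move=> p_born e1 q.
have odd_q : grid_odd q = ~~ grid_odd p by rewrite grid_odd_shift.
have pE : p = grid_shift (grid_odd q) (- e) q by rewrite odd_q grid_shiftK.
set p' := grid_shift (grid_odd q) e q.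
have p'_end : grid_shift (~~ grid_odd p') (- e) p' = q.
  by rewrite grid_odd_shift // negbK grid_shiftK.
have p'p : p' != p.
  apply/eqP; rewrite pE /p' /grid_shift; case: ifP => _ [] //= /addrI; lia.
have q_neq0 : q != (0, 0).
  apply/eqP => q0; move: p_born; rewrite pE q0 /born_by /grid_birth /=.
  by rewrite add0r abszN e1.
have birth_q : grid_birth q = birth (grid_birth p) (grid_birth p').
  by rewrite birthC pE; apply: grid_birth_neighbor.
apply/andP/eqP => [[_ /forallP exp]|q_birth].
  have exp' r : born_by n r -> r != p ->
      (grid_point q \notin ends (grid_toothpick r)) && (q != r).
    move=> r_born r_neq; rewrite -mem_stage in r_born.
    have /implyP := exp [` r_born]; rewrite /= (inj_eq grid_toothpick_inj).
    by rewrite (inj_eq grid_point_inj); apply.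
  rewrite birth_q; apply: born_next => //.
    apply/negP => p'_born; have /andP[/negP] := exp' _ p'_born p'p.
    case; apply/ends_grid_toothpick; exists (- e); first by rewrite abszN.
    by rewrite p'_end.
  rewrite -birth_q; apply/negP => q_born.
  have q_neq : q != p.
    by apply/eqP => qp; move: odd_q; rewrite qp; case: grid_odd.
  by have /andP[_ /eqP] := exp' _ q_born q_neq.
split; first by apply/ends_grid_toothpick; exists e.
apply/forallP => -[u /= u_S]; apply/implyP; case/S_def: (u_S) => r -> r_born.
rewrite (inj_eq grid_toothpick_inj) (inj_eq grid_point_inj) => r_neq.
apply/andP; split; last first.
  by apply/eqP => qr; move: r_born; rewrite /born_by -qr q_birth; lia.
apply/negP => /ends_grid_toothpick[f f1 /grid_point_inj qE].
have rE : r = grid_shift (grid_odd q) (- f) q.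
  have -> : grid_odd q = ~~ grid_odd r by rewrite qE grid_odd_shift.
  by rewrite qE grid_shiftK.
have /orP[/eqP fe|/eqP fe] : (f == e) || (f == - e) by lia.
  by rewrite rE fe -pE eqxx in r_neq.
have rp' : r = p' by rewrite rE fe opprK.
have := birth_eqS n_gt0 (esym (etrans (esym q_birth) birth_q)).
by move: r_born p_born; rewrite rp' /born_by => -> -> /= [].
Qed.

Lemma added_stage s :
  reflect (exists2 p, s = grid_toothpick p & grid_birth p = n.+1) (s \in added S).
Proof.
rewrite /added.
apply: (iffP (imfset2P _ _ _ _ _)) => [[_ /S_def[p -> p_born] [v]]|[q -> q_birth]].
  rewrite !inE /= => /andP[_ v_exp] ->.
  have /andP[/ends_grid_toothpick[e e1 vE] _] := v_exp.
  move: v_exp; rewrite vE exposed_grid_toothpick // => /eqP.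
  exists (grid_shift (~~ grid_odd p) e p) => //.
  by rewrite /perpendicular_at /grid_toothpick grid_odd_shift // negbK.
(* A point born at stage [n.+1] has exactly one neighbour born by stage [n], from whose end it
   grows. *)
have [e e1 p_born] : exists2 e : int, `|e|%N = 1%N &
    born_by n (grid_shift (grid_odd q) e q).
  have := q_birth; rewrite grid_birth_step.
    by case/(birth_eqS n_gt0) => /andP[born _]; [exists 1 | exists (- 1)].
  by apply/eqP => q0; move: q_birth; rewrite q0 => -[n0]; move: n_gt0; rewrite -n0.
pose p := grid_shift (grid_odd q) e q.
have qE : q = grid_shift (~~ grid_odd p) (- e) p.
  by rewrite grid_odd_shift // negbK grid_shiftK.
exists (grid_toothpick p); first by rewrite mem_stage.
have Ne1 : `|- e|%N = 1%N by rewrite abszN.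
exists (grid_point q).
  have q_exp : exposed S (grid_toothpick p) (grid_point q).
    by rewrite {1}qE exposed_grid_toothpick // -qE q_birth.
  by have /andP[] := q_exp; rewrite !inE /= q_exp => ->.
by rewrite /perpendicular_at /grid_toothpick /= grid_odd_shift // negbK.
Qed.

End Stage.

Lemma structureP n s : (0 < n)%N ->
  reflect (exists2 p, s = grid_toothpick p & born_by n p) (s \in structure R n).
Proof.
case: n => // n _; elim: n s => [|n IHn] s.
  have tooth0 : Toothpick (0, 0) true = grid_toothpick (0, 0).
    by rewrite /grid_toothpick /grid_point /= !mul0r.
  rewrite /= inE tooth0; apply: (iffP eqP) => [->|[p ->]]; first by exists (0, 0).
  (* Away from the origin the rule yields 0 or the successor of a positive number, never 1. *)
  rewrite /born_by => p_born; congr grid_toothpick; apply/eqP; apply/negPn/negP => p_neq0.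
  have := grid_birth_step p_neq0; rewrite /birth; move: p_born.
  by do ! case: eqP; lia.
have -> : structure R n.+2 = structure R n.+1 `|` added (structure R n.+1) by [].
rewrite inE; apply: (iffP orP) => [[/IHn[p -> p_born]|]|[p ->]].
- by exists p => //; move: p_born; rewrite /born_by; lia.
- case/(added_stage (ltn0Sn n) IHn) => p -> p_birth.
  by exists p => //; rewrite /born_by p_birth; lia.
rewrite /born_by => p_born; have [p_le|p_gt] := leqP (grid_birth p) n.+1; [left | right].
  by apply/IHn; exists p => //; rewrite /born_by p_le andbT; lia.
by apply/(added_stage (ltn0Sn n) IHn); exists p => //; lia.
Qed.

End Grid.

(** * Counting *)

Lemma quadrant_birth_ge x y n : 0 < x -> 0 < y -> 0 < n ->
  quadrant_birth x y = n -> [&& x.*2 <= n, y.*2 <= n & x + y < n].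
Proof.
move=> x_gt0 y_gt0 n_gt0; have [leyx|ltxy] := leqP y x.
  rewrite quadrant_birth_low // => xyn.
  have := @octant_birth_ge x y; rewrite /no_sooner xyn; lia.
rewrite quadrant_birth_high //; last by lia.
move=> xyn; have := @octant_birth_ge y.-1 x; move: xyn; rewrite /no_sooner /delay.
by case: eqP; lia.
Qed.

Definition octant_count (m n : nat) : nat :=
  \sum_(x < m) \sum_(y < m) ((0 < y <= x) && (octant_birth x y == n)).

(** The upper half of the quadrant is the octant delayed by one, hence the second count at [n]. *)
Lemma quadrant_count m n : 0 < n -> n.+1 < m.*2 ->
  \sum_(x < m) \sum_(y < m)
     [&& 0 < x, 0 < y & quadrant_birth x y == n.+1] =
  octant_count m n.+1 + octant_count m n.
Proof.
move=> n_gt0; case: m => [//|m] lt_nm.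
have -> : octant_count m.+1 n =
    \sum_(x < m.+1) \sum_(y < m.+1) ((0 < x < y) && (octant_birth y.-1 x == n)).
  rewrite exchange_big [RHS]big_ord_recl /octant_count big_ord_recr /=.
  (* Column [m] contributes nothing, since births there are at least [m.*2.+1 > n]. *)
  rewrite [X in _ + X = _]big1 => [|x _]; last first.
    have [x_int|//] := boolP (0 < x <= m).
    apply/eqP; rewrite eqb0 andTb; apply/eqP => b_eq.
    by have := octant_birth_ge x_int; rewrite /no_sooner b_eq; lia.
  rewrite [X in _ = X + _]big1 => [|x _]; last by case: (nat_of_ord x).
  by rewrite addn0 add0n.
rewrite -big_split; apply: eq_bigr => x _; rewrite -big_split; apply: eq_bigr => y _ /=.
have [x0|x_gt0] := posnP x; first by rewrite x0; case: (nat_of_ord y).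
have [y0|y_gt0] := posnP y; first by rewrite y0 ltn0.
have [leyx|ltxy] := leqP y x; first by rewrite quadrant_birth_low // addn0.
rewrite quadrant_birth_high ?add0n //; last by lia.
rewrite /delay /=; case: (octant_birth _ _) => [|b]; last by rewrite add1n.
by case: (n) n_gt0.
Qed.

Section Count.
Variable R : realType.
Local Open Scope fset_scope.

Lemma new_toothpickP n s :
  reflect (exists2 p, s = grid_toothpick R p & grid_birth p = n.+2)
    (s \in structure R n.+2 `\` structure R n.+1).
Proof.
rewrite in_fsetD.
apply: (iffP andP) => [[nold /structureP[] // p sp p_born]|[p -> p_birth]].
  exists p => //; apply/eqP; rewrite eqn_leq; move: p_born.
  rewrite /born_by => /andP[p_gt0 ->] /=.
  rewrite ltnNge; apply: contra nold => p_le; apply/structureP => //.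
  by exists p => //; rewrite /born_by p_gt0.
split; last by apply/structureP => //; exists p => //; rewrite /born_by p_birth /=.
apply/negP => /structureP[] // q /grid_toothpick_inj <-.
by rewrite /born_by p_birth ltnn.
Qed.

(** Stage 2 is counted by hand: its toothpicks are centred on the y-axis, where the quadrants
    meet. *)
Lemma t_2 : t R 2 = 2.
Proof.
suff -> : t R 2 = #|` [fset grid_toothpick R (0, 1)%R; grid_toothpick R (0, -1)%R]|.
  by rewrite cardfs2 (inj_eq (@grid_toothpick_inj R)).
congr (#|` _ |); apply/fsetP => s; rewrite in_fset2; apply/new_toothpickP/orP.
  case=> -[x y] -> p_birth.
  suff: (x == 0%R) && ((y == 1%R) || (y == -1)%R).
    by case/andP => /eqP-> /orP[] /eqP->; [left | right].
  move: p_birth; rewrite /grid_birth /=.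
  have [->|x_neq0] := eqVneq x 0%R.
    by rewrite /quadrant_birth /=; do ! case: eqP; lia.
  have [->|y_neq0] := eqVneq y 0%R; first by rewrite quadrant_birthx0 //; lia.
  by move/quadrant_birth_ge; lia.
by case=> /eqP ->; [exists (0, 1)%R | exists (0, -1)%R].
Qed.

Definition signed (b : bool) (n : nat) : int := (if b then - n%:Z else n%:Z)%R.

(** From stage 3 on the new midpoints avoid both axes, so the four sign choices give disjoint copies
    of the quadrant count. *)
Lemma t_octant_count m n : 1 < n -> n.+1 < m.*2 ->
  t R n.+1 = 4 * (octant_count m n.+1 + octant_count m n).
Proof.
case: n => // -[|n] // _ lt_nm; rewrite -quadrant_count //.
pose B := [set u : 'I_m * 'I_m |
             [&& 0 < u.1, 0 < u.2 & quadrant_birth u.1 u.2 == n.+3]]%SET.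
pose A := finset.setX [set: bool * bool]%SET B.
pose f (w : (bool * bool) * ('I_m * 'I_m)) :=
  grid_toothpick R (signed w.1.1 w.2.1, signed w.1.2 w.2.2).
have -> : t R n.+3 = #|` [fset s in map f (enum A)]|.
  congr (#|` _ |); apply/fsetP => s; rewrite [RHS]in_fset; apply/new_toothpickP/mapP.
    case=> -[x y] -> p_birth.
    have x_neq0 : x != 0%R.
      apply/eqP => x0; move: p_birth; rewrite x0 /grid_birth /quadrant_birth /=.
      by do ! case: eqP.
    have y_neq0 : y != 0%R.
      apply/eqP => y0; move: p_birth; rewrite y0 /grid_birth quadrant_birthx0 //=; lia.
    have [ltx lty] : `|x| < m /\ `|y| < m.
      by move: p_birth => /quadrant_birth_ge /=; lia.
    exists ((x < 0, y < 0)%R, (Ordinal ltx, Ordinal lty)).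
      rewrite mem_enum !inE /=; apply/and3P; split; [lia | lia | exact/eqP].
    by rewrite /f /signed /=; congr (grid_toothpick R (_, _)); case: ltrP; lia.
  case=> -[[b c] [x y]]; rewrite mem_enum !inE /= => /and3P[x_gt0 y_gt0 /eqP xyn] ->.
  exists (signed b x, signed c y) => //; rewrite /grid_birth -xyn /=.
  by congr quadrant_birth; rewrite /signed; case: ifP; lia.
have f_inj : {in enum A &, injective f}.
  move=> [[b c] [x y]] [[b' c'] [x' y']]; rewrite !mem_enum !inE /=.
  move=> /and3P[x_gt0 y_gt0 _] /and3P[x_gt0' y_gt0' _] /grid_toothpick_inj[].
  rewrite /signed => xx yy.
  have -> : b = b' by case: b b' xx => -[]; lia.
  have -> : c = c' by case: c c' yy => -[]; lia.
  congr (_, (_, _)); apply: val_inj => /=; [move: xx | move: yy]; do 2 case: ifP; lia.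
rewrite card_fseq undup_id ?map_inj_in_uniq ?enum_uniq // size_map -cardE.
rewrite cardsX cardsT card_prod card_bool; congr (4 * _).
rewrite cardsE -sum1_card big_mkcond pair_big /=; apply: eq_bigr => -[x y] _ /=.
by rewrite unfold_in /=; case: and3P.
Qed.

End Count.

(** * Generating polynomials of the octant *)

Section Polynomials.
Variable R : realType.
Local Open Scope ring_scope.
Implicit Types (k m n i j x y : nat).

Definition birth_monomial (b : nat) : {poly R} := if b == 0%N then 0 else 'X^b.

Lemma birth_monomial_delay s b :
  birth_monomial (delay s b) = 'X^s * birth_monomial b.
Proof.
rewrite /birth_monomial /delay; case: b => [|b] /=; first by rewrite mulr0.
by rewrite addnS -exprD addnS.
Qed.

Definition octant_term x y : {poly R} :=
  if (0 < y <= x)%N then birth_monomial (octant_birth x y) else 0.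

Definition octant_poly m : {poly R} := \sum_(x < m) \sum_(y < m) octant_term x y.

Lemma coef_octant_poly m n : (octant_poly m)`_n.+1 = (octant_count m n.+1)%:R.
Proof.
rewrite /octant_poly /octant_count coef_sum natr_sum; apply: eq_bigr => x _.
rewrite coef_sum natr_sum; apply: eq_bigr => y _; rewrite /octant_term.
case: ifP => _; last by rewrite coef0.
rewrite /birth_monomial; case: (octant_birth x y) => [|b] /=; first by rewrite coef0.
by rewrite coefXn eq_sym.
Qed.

Lemma sum_ord_shift (V : zmodType) m (g : nat -> V) : g 0%N = g m ->
  \sum_(j < m) g j.+1 = \sum_(j < m) g j.
Proof.
move=> g0m; apply: (addrI (g 0%N)).
by rewrite -[LHS](big_ord_recl m (fun j : 'I_m.+1 => g j)) big_ord_recr g0m addrC.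
Qed.

Definition stage_factor k : {poly R} := 1 + 'X^((2 ^ k).-1) * (1 + 2 *: 'X).

Lemma octant_polyD k :
  octant_poly (2 ^ k.+1) =
    octant_poly (2 ^ k) * stage_factor k.+1 + 'X^((2 ^ k.+1).+1).
Proof.
set m := (2 ^ k)%N; have m_gt0 : (0 < m)%N by rewrite expn_gt0.
have mm : (2 ^ k.+1 = m + m)%N by rewrite expnS mul2n addnn.
rewrite mm {1}/octant_poly big_split_ord /=.
have -> : \sum_(x < m) \sum_(y < m + m) octant_term x y = octant_poly m.
  apply: eq_bigr => x _; rewrite big_split_ord /= [X in _ + X]big1 ?addr0 // => y _.
  by rewrite /octant_term ifF //; have := ltn_ord x; lia.
under eq_bigr => x _ do rewrite big_split_ord /=.
rewrite big_split /=.
have -> : \sum_(x < m) \sum_(y < m) octant_term (m + x) (m + y) =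
    'X^((m + m).+1) + 'X^(m + m) * octant_poly m.
  (* This monomial comes from the corner [(m, m)]; as a double sum it can be compared term by
     term. *)
  have -> : 'X^((m + m).+1) =
      \sum_(x < m) \sum_(y < m) if (x == 0%N :> nat) && (y == 0%N :> nat)
                                then 'X^((m + m).+1) else 0 :> {poly R}.
    rewrite -(prednK m_gt0) big_ord_recl /= [X in _ + X]big1 ?addr0 => [|x _].
      by rewrite big_ord_recl /= [X in _ + X]big1 ?addr0.
    by rewrite big1.
  rewrite /octant_poly mulr_sumr -big_split; apply: eq_bigr => x _.
  rewrite mulr_sumr -big_split; apply: eq_bigr => y _ /=; rewrite /octant_term.
  have [y0|y_gt0] := posnP y.
    rewrite y0 addn0 /= mulr0 addr0 ifT; last by lia.
    rewrite octant_birthDm // andbT /birth_monomial addnn.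
    by case: (nat_of_ord x).
  rewrite andbF add0r leq_add2l addn_gt0 y_gt0 orbT /=.
  case: ifP => _; last by rewrite mulr0.
  by rewrite octant_birthDD // birth_monomial_delay addnn.
(* In column [m + x], the point at distance [y] below height [m] is the reflected image of [(x, y)]
   if [y <= x], and otherwise the rotated image of [(y, x.+1)]. The terms at distances 0 and [m]
   vanish, which permits the index shift below. *)
pose refl x y : {poly R} := 'X^(m + m) * octant_term x y.
pose rot x y : {poly R} :=
  if (x < y < m)%N then 'X^((m + m).-1) * octant_term y x.+1 else 0.
have lower x : (x < m)%N -> \sum_(y < m) octant_term (m + x) y =
    \sum_(y < m) (refl x y + rot x y).
  move=> ltx; rewrite -(sum_ord_shift (g := fun y => refl x y + rot x y)); last first.
    by rewrite /refl /rot /octant_term /= !ltnn (leqNgt m) ltx !andbF ?ltn0.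
  rewrite (reindex_inj rev_ord_inj); apply: eq_bigr => j _ /=.
  have := ltn_ord j; move: (nat_of_ord j) => {}j ltj.
  rewrite /refl /rot /octant_term.
  have [jm|j_neq] := eqVneq j.+1 m.
    rewrite jm subnn /= ltnn !andbF addr0 ifF ?mulr0 //; lia.
  rewrite ifT; last by lia.
  have [lejx|gtjx] := leqP j.+1 x.
    by rewrite octant_birthDB // birth_monomial_delay addnn addr0.
  rewrite /= mulr0 add0r ifT; last by lia.
  have -> : (m + x = m.-1 + x.+1)%N by lia.
  by rewrite octant_birth_rot ?birth_monomial_delay ?addnn //; lia.
under eq_bigr => x _ do rewrite lower //.
under eq_bigr => x _ do rewrite big_split /=.
rewrite big_split /=.
have -> : \sum_(x < m) \sum_(y < m) refl x y = 'X^(m + m) * octant_poly m.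
  by rewrite mulr_sumr; apply: eq_bigr => x _; rewrite mulr_sumr.
have -> : \sum_(x < m) \sum_(y < m) rot x y = 'X^((m + m).-1) * octant_poly m.
  rewrite exchange_big mulr_sumr; apply: eq_bigr => y _ /=; rewrite mulr_sumr.
  pose g x := 'X^((m + m).-1) * octant_term y x.
  rewrite -(sum_ord_shift (g := g)); last first.
    by rewrite /g /octant_term (leqNgt m) ltn_ord !andbF.
  apply: eq_bigr => x _; rewrite /rot /g ltn_ord andbT /octant_term.
  by case: ltnP; rewrite ?mulr0.
rewrite /stage_factor mm.
have -> : 'X^(m + m) = 'X^((m + m).-1) * 'X :> {poly R}.
  by rewrite -exprSr prednK // addn_gt0 m_gt0.
rewrite scaler_nat; ring.
Qed.

Definition stage_product k : {poly R} := \prod_(j < k) stage_factor j.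

Definition stage_tail k : {poly R} := \prod_(j < k) stage_factor j.+1.

(** The factor of index 0 reflects the two octants of a quadrant, one of them delayed by a stage. *)
Lemma stage_productS k : stage_product k.+1 = (2 + 2 *: 'X) * stage_tail k.
Proof.
rewrite /stage_product big_ord_recl /stage_factor /= expr0 mul1r addrA.
by congr (_ * _).
Qed.

(** This combination absorbs the inhomogeneous term of the recursion [octant_polyD], leaving a pure
    product. *)
Lemma octant_poly_tail k :
  'X^2 + (1 + 2 *: 'X) * octant_poly (2 ^ k) = 'X^2 * stage_tail k.
Proof.
elim: k => [|k IHk].
  rewrite /octant_poly /stage_tail !big_ord1 /octant_term /= big_ord0.
  by rewrite mulr0 addr0 mulr1.
rewrite /stage_tail big_ord_recr /= -/(stage_tail k) mulrA -IHk octant_polyD.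
have -> : 'X^((2 ^ k.+1).+1) = 'X^((2 ^ k.+1).-1) * 'X^2 :> {poly R}.
  by rewrite -exprD; congr 'X^_; have := expn_gt0 2 k.+1; lia.
rewrite /stage_factor; ring.
Qed.

Lemma octant_polyS k : octant_poly (2 ^ k.+1) =
  octant_poly (2 ^ k) + 'X^((2 ^ k.+1).+1) * stage_tail k.
Proof.
have e : 'X^((2 ^ k.+1).+1) = 'X^((2 ^ k.+1).-1) * 'X^2 :> {poly R}.
  by rewrite -exprD; congr 'X^_; have := expn_gt0 2 k.+1; lia.
rewrite octant_polyD e -mulrA -octant_poly_tail /stage_factor; ring.
Qed.

Lemma size_stage_factor k : (size (stage_factor k) <= (2 ^ k).+1)%N.
Proof.
have m_gt0 := expn_gt0 2 k.
apply: leq_trans (size_polyD _ _) _; rewrite geq_max size_poly1 /=.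
apply: leq_trans (size_polyMleq _ _) _; rewrite size_polyXn.
suff : (size ((1 + 2 *: 'X)%R : {poly R}) <= 2)%N by lia.
apply: leq_trans (size_polyD _ _) _; rewrite geq_max size_poly1 /=.
by apply: leq_trans (size_scale_leq _ _) _; rewrite size_polyX.
Qed.

Lemma size_stage_tail k : (size (stage_tail k) < 2 ^ k.+1)%N.
Proof.
elim: k => [|k IHk]; first by rewrite /stage_tail big_ord0 size_poly1.
rewrite /stage_tail big_ord_recr /= -/(stage_tail k).
apply: leq_ltn_trans (size_polyMleq _ _) _.
have := size_stage_factor k.+1; rewrite [(2 ^ k.+2)%N]expnS; lia.
Qed.

Lemma size_octant_poly k : (size (octant_poly (2 ^ k)) <= 2 ^ k.+1)%N.
Proof.
elim: k => [|k IHk].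
  by rewrite /octant_poly !big_ord1 /octant_term /= size_poly0.
rewrite octant_polyS; apply: leq_trans (size_polyD _ _) _.
rewrite geq_max; apply/andP; split.
  by apply: leq_trans IHk _; rewrite leq_exp2l.
apply: leq_trans (size_polyMleq _ _) _; rewrite size_polyXn.
have := size_stage_tail k; rewrite [(2 ^ k.+2)%N]expnS; lia.
Qed.

Lemma coef_linear (p : {poly R}) n :
  ((2 + 2 *: 'X) * p)`_n.+1 = 2 * (p`_n.+1 + p`_n).
Proof.
by rewrite mulrDl coefD -scalerAl coefZ coefXM -polyC_natr coefCM mulrDr.
Qed.

Lemma octant_count_coef k i : (i < 2 ^ k.+1)%N ->
  2 * (octant_count (2 ^ k.+2) (2 ^ k.+1 + 1 + i) +
       octant_count (2 ^ k.+2) (2 ^ k.+1 + i))%:R = (stage_product k.+1)`_i.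
Proof.
move=> lti; have m_gt0 := expn_gt0 2 k.+1.
set m := (2 ^ k.+1)%N in lti m_gt0 *.
have -> : 2 * (octant_count (2 ^ k.+2) (m + 1 + i) +
    octant_count (2 ^ k.+2) (m + i))%:R =
    ((2 + 2 *: 'X) * octant_poly (2 ^ k.+2))`_(m + 1 + i).
  rewrite addnAC addn1 coef_linear natrD -coef_octant_poly; congr (_ * (_ + _)).
  by case: (m + i)%N (ltn_addr i m_gt0) => // n _; rewrite coef_octant_poly.
(* Of the three summands, the one with [octant_poly (2 ^ k)] has too small a degree and the last
   starts beyond [m + 1 + i]; the middle one is [stage_product k.+1] shifted by [m.+1]. *)
rewrite octant_polyS octant_polyS !mulrDr !coefD.
rewrite nth_default ?add0r; last first.
  have size2 : (size ((2 + 2 *: 'X)%R : {poly R}) <= 2)%N.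
    apply: leq_trans (size_polyD _ _) _; rewrite geq_max -polyC_natr.
    rewrite (leq_trans (size_polyC_leq1 _)) //=.
    by apply: leq_trans (size_scale_leq _ _) _; rewrite size_polyX.
  apply: leq_trans (size_polyMleq _ _) _.
  by have := size_octant_poly k; rewrite -/m; lia.
rewrite [X in _ + X](_ : _ = 0) ?addr0.
  rewrite mulrCA -stage_productS coefXnM -/m addn1 addSn ltnS ltnNge leq_addr.
  by rewrite subSS addKn.
rewrite mulrCA coefXnM ifT // ltnS [(2 ^ k.+2)%N]expnS -/m.
by clear -lti; move: m lti => m; lia.
Qed.

End Polynomials.

(** * Binary weight *)

Lemma wtE k n : n < 2 ^ k -> wt n = \sum_(j < k) odd (n %/ 2 ^ j).
Proof.
have widen a b : n < 2 ^ a ->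
    \sum_(j < a + b) odd (n %/ 2 ^ j) = \sum_(j < a) odd (n %/ 2 ^ j).
  move=> lt_na; rewrite big_split_ord /= [X in _ + X]big1 ?addn0 // => j _.
  by rewrite divn_small // (leq_trans lt_na) // leq_exp2l // leq_addr.
move=> lt_nk; rewrite -(widen k n lt_nk) addnC.
by rewrite (widen n k (ltn_expl n (ltnSn 1))).
Qed.

Lemma wt_leq n : wt n <= n.
Proof.
apply: leq_trans (_ : \sum_(j < n) 1 <= n); last by rewrite sum1_card card_ord.
by apply: leq_sum => j _; case: odd.
Qed.

Lemma wt_add_exp2 k n : n < 2 ^ k -> wt (2 ^ k + n) = (wt n).+1.
Proof.
move=> lt_nk; rewrite (@wtE k.+1); last by rewrite expnS; lia.
rewrite (wtE lt_nk) big_ord_recr /= divnDl ?dvdnn // divnn expn_gt0 /=.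
rewrite divn_small // addn1; congr _.+1; apply: eq_bigr => j _.
have jk : 2 ^ k = 2 ^ (k - j) * 2 ^ j by rewrite -expnD subnK // ltnW.
rewrite jk divnMDl ?expn_gt0 // oddD oddX subn_eq0 leqNgt ltn_ord.
by [].
Qed.

(** * Coefficients of the product *)

Section Formula.
Variable R : realType.
Local Open Scope ring_scope.
Implicit Types (k m n i j : nat).

(* Summed over [n], the coefficient of [X^i] is the sum of the formula indexed by
   [m = n - i]. *)
Definition wt_poly n : {poly R} := 'X^(n - wt n) * (1 + 2 *: 'X) ^+ wt n.

(** Expanding the product selects a set of indices [j], the positions of the ones of [n]; the
    exponents [2 ^ j - 1] add up to [n - wt n]. The induction splits off the leading digit. *)
Lemma stage_productE k : stage_product R k = \sum_(n < 2 ^ k) wt_poly n.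
Proof.
elim: k => [|k IHk].
  by rewrite /stage_product big_ord0 expn0 big_ord1 /wt_poly /wt big_ord0 mulr1.
rewrite expnS mul2n -addnn big_split_ord /= -IHk.
rewrite /stage_product big_ord_recr /= -/(stage_product R k).
rewrite /stage_factor mulrDr mulr1; congr (_ + _).
rewrite IHk mulr_suml; apply: eq_bigr => n _.
rewrite /wt_poly wt_add_exp2 // exprS.
have -> : (2 ^ k + n - (wt n).+1 = (n - wt n) + (2 ^ k).-1)%N.
  by have := wt_leq n; have := expn_gt0 2 k; lia.
rewrite exprD; ring.
Qed.

Lemma coef_wt_poly n i : (wt_poly n)`_i =
  if (i < n - wt n)%N then 0
  else 2 ^+ (i - (n - wt n)) * 'C(wt n, i - (n - wt n))%:R.
Proof.
rewrite coefXnM; case: ifP => // _; move: (i - _)%N => j.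
rewrite addrC exprD1n coef_sum.
have [lejw|ltwj] := leqP j (wt n).
  rewrite (bigD1 (Ordinal (lejw : (j < (wt n).+1)%N))) //= big1 ?addr0 => [|l neq_lj].
    by rewrite exprZn coefMn coefZ coefXn eqxx mulr1 mulr_natr.
  rewrite exprZn coefMn coefZ coefXn; move: neq_lj.
  rewrite -val_eqE /= eq_sym => /negPf->.
  by rewrite mulr0 mul0rn.
rewrite bin_small // mulr0 big1 // => l _.
rewrite exprZn coefMn coefZ coefXn gtn_eqF ?mulr0 ?mul0rn //.
by have := ltn_ord l; lia.
Qed.

(** The exponent is negative only for [m > wt (i + m)], where the binomial coefficient vanishes. *)
Definition wt_term i m : R :=
  (2 : R) ^ ((wt (i + m))%:Z - m%:Z) * 'C(wt (i + m), m)%:R.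

Lemma coef_wt_poly_add i m : (wt_poly (i + m))`_i = wt_term i m.
Proof.
rewrite coef_wt_poly /wt_term; have lew := wt_leq (i + m).
have [lemw|ltwm] := leqP m (wt (i + m)); last first.
  by rewrite [in RHS]bin_small // mulr0 ifT //; lia.
rewrite ifF; last by lia.
have -> : (i - (i + m - wt (i + m)) = wt (i + m) - m)%N by lia.
by rewrite bin_sub // subzn.
Qed.

(** Since [wt_poly n] has degree [n], only the terms [n = i + m] contribute. *)
Lemma coef_stage_product k i : (i <= 2 ^ k)%N ->
  (stage_product R k)`_i = \sum_(m < 2 ^ k - i) wt_term i m.
Proof.
move=> leik; rewrite stage_productE coef_sum.
rewrite -(big_mkord xpredT (fun n => (wt_poly n)`_i)) -{1}(subnKC leik).
rewrite big_mkord big_split_ord /=.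
rewrite big1 ?add0r => [|n _].
  by apply: eq_bigr => m _; rewrite coef_wt_poly_add.
have lew := wt_leq n; have ltn_i := ltn_ord n.
by rewrite coef_wt_poly bin_small ?mulr0 ?if_same //; lia.
Qed.

(** A factor of index [j >= k] alters only coefficients from [2 ^ j - 1] on. *)
Lemma stage_product_stable k l i : (i + 2 <= 2 ^ k)%N ->
  (stage_product R (k + l))`_i = (stage_product R k)`_i.
Proof.
move=> leik; elim: l => [|l IHl]; first by rewrite addn0.
rewrite addnS /stage_product big_ord_recr /= -/(stage_product R (k + l)) -IHl.
rewrite /stage_factor mulrDr mulr1 mulrCA coefD coefXnM ifT ?addr0 //.
have : (2 ^ k <= 2 ^ (k + l))%N by rewrite leq_exp2l // leq_addr.
by lia.
Qed.

Lemma wt_sum k i : (i + 2 <= 2 ^ k)%N ->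
  \sum_(m \in [set: nat]%classic) wt_term i m = (stage_product R k)`_i.
Proof.
(* With this [K] the finite sum contains every [m <= i.+2], and beyond that the terms vanish by
   [bin_wt_eq0]. *)
move=> leik; pose K := (k + i.+3)%N.
have leiK : (i.*2 + 3 <= 2 ^ K)%N.
  have : (2 ^ i.+3 <= 2 ^ K)%N by rewrite leq_exp2l // leq_addl.
  by have := ltn_expl i (ltnSn 1); rewrite !expnS; lia.
rewrite -(stage_product_stable i.+3 leik) -/K coef_stage_product; last by lia.
rewrite -(big_mkord xpredT).
rewrite (@fsbigE _ _ _ _ _ (index_iota 0 (2 ^ K - i))) ?iota_uniq //.
  by apply: eq_bigl => m; rewrite in_setT.
move=> m _; rewrite mem_index_iota /= => lem.
by rewrite /wt_term bin_wt_eq0 ?mulr0 //; lia.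
Qed.

(** Only the term [m = 0] remains, and [2 ^ k - 1] has [k] ones. The factor of index [k] would
    already change this coefficient, whence the exceptional case of the formula. *)
Lemma stage_product_last k : (stage_product R k)`_(2 ^ k - 1) = 2 ^+ k.
Proof.
rewrite coef_stage_product ?leq_subr //.
have -> : (2 ^ k - (2 ^ k - 1) = 1)%N by have := expn_gt0 2 k; lia.
rewrite big_ord1 /wt_term bin0 mulr1 addn0 subr0 (@wtE k); last first.
  by have := expn_gt0 2 k; lia.
rewrite (_ : (\sum_(j < k) _)%N = k) //; rewrite -[RHS]card_ord -sum1_card.
apply: eq_bigr => j _.
(* Bit [j] is the parity of the quotient [(2 ^ (k - j)).-1], which is odd. *)
have -> : (2 ^ k - 1 = (2 ^ (k - j)).-1 * 2 ^ j + (2 ^ j).-1)%N.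
  have -> : (2 ^ k = 2 ^ (k - j) * 2 ^ j)%N by rewrite -expnD subnK // ltnW.
  by have := expn_gt0 2 (k - j); have := expn_gt0 2 j; nia.
rewrite divnMDl ?expn_gt0 // divn_small ?addn0; last by have := expn_gt0 2 j; lia.
have : (0 < k - j)%N by rewrite subn_gt0.
case: (k - j)%N => // l _; rewrite expnS.
by have := expn_gt0 2 l; lia.
Qed.

Lemma t_coef k i : (i < 2 ^ k)%N ->
  (t R (2 ^ k + 1 + i))%:R = 2 * (stage_product R k)`_i :> R.
Proof.
case: k => [|k] lti.
  have -> : i = 0%N by rewrite expn0 in lti; lia.
  by rewrite addn0 t_2 /stage_product big_ord0 coef1 mulr1.
have m_gt1 : (1 < 2 ^ k.+1)%N by rewrite (@ltn_exp2l 2 0).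
rewrite -octant_count_coef // mulrA -natrM addnAC addn1.
rewrite (@t_octant_count R (2 ^ k.+2)) ?ltn_addr ?natrM //.
by rewrite [(2 ^ k.+2)%N]expnS; lia.
Qed.

End Formula.

Unset Implicit Arguments.
Local Open Scope classical_set_scope.
Local Open Scope ring_scope.

Theorem theorem9 (R : realType) (k i : nat) (hi : (i <= 2 ^ k - 1)%N) :
  (t R (2 ^ k + 1 + i))%:R =
    (if (i + 2 <= 2 ^ k)%N then
       2 * \sum_(m \in [set: nat])
             ((2 : R) ^ ((wt (i + m))%:Z - m%:Z) * 'C(wt (i + m), m)%:R)
     else (2 ^ (k + 1))%N%:R) :> R.
Proof.
have m_gt0 := expn_gt0 2 k.
rewrite t_coef; last by lia.
case: ifP => [le_ik|gt_ik]; first by rewrite -(wt_sum R le_ik).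
have -> : i = (2 ^ k - 1)%N by lia.
by rewrite stage_product_last addn1 expnS natrM natrX.
Qed.
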